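(* If the sets $\Lambda=\{\lambda_0,\lambda_1,\ldots\}$ and $\Lambda'=\{\lambda'_0,\lambda'_1,\ldots\}$ are type 1, then the Minkowski sum $\Lambda+\Lambda'=\{\lambda+\lambda':\lambda\in\Lambda,\ \lambda'\in\Lambda'\}$ is also type 1.
   Context: A set $\Lambda\subset\mathbb{R}$ is called admissible if it is countably infinite, unbounded, bounded from below, and has no finite accumulation points; type 1 and type 2 sets are by definition admissible. The Minkowski sum is regarded as a set (without multiplicities). Let $\mu$ denote Lebesgue measure on $\mathbb{R}$. For an admissible $\Lambda$ and a (Lebesgue) measurable $f:\mathbb{R}\to[0,+\infty)$, put $s(x)=\sum_{\lambda\in\Lambda}f(x+\lambda)$, $C(f,\Lambda)=\{x\in\mathbb{R}: s(x)<\infty\}$ and $D(f,\Lambda)=\{x\in\mathbb{R}: s(x)=\infty\}$. The set $\Lambda$ is type 1 if for every measurable $f:\mathbb{R}\to[0,+\infty)$ either $\mu(D(f,\Lambda))=0$ or $\mu(C(f,\Lambda))=0$. Otherwise $\Lambda$ is type 2. *)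

(* Defs.v *)
From HB Require Import structures.
From mathcomp Require Import all_boot all_order all_algebra.
From mathcomp Require Import all_classical all_reals all_analysis.

Set Implicit Arguments.
Unset Strict Implicit.
Unset Printing Implicit Defensive.

Import Order.TTheory GRing.Theory Num.Theory.
Import numFieldNormedType.Exports.

Local Open Scope classical_set_scope.
Local Open Scope ring_scope.

Definition admissible (R : realType) (Lambda : set R) : Prop :=
  [/\ countable Lambda, infinite_set Lambda, ~ bounded_set Lambda,
      has_lbound Lambda & limit_point Lambda = set0].

(* The domain carries the sigma-algebra of [completed_lebesgue_measure], i.e.,
   the Lebesgue sets (see [completed_caratheodory_measurable]); the default
   sigma-algebra on [R], kept here on the codomain, is the Borel one. *)
Definition lebesgue_measurable_fun (R : realType) (f : R -> R) : Prop :=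
  measurable_fun [set: caratheodory_type (@wlength R idfun)^*%mu] f.

(* [esum] ranges over the set [Lambda], so there are no multiplicities. *)
Definition translate_sum (R : realType) (f : R -> R) (Lambda : set R) (x : R)
    : \bar R :=
  \esum_(l in Lambda) (f (x + l))%:E.

Definition convergence_set (R : realType) (f : R -> R) (Lambda : set R)
    : set R :=
  [set x | (translate_sum f Lambda x < +oo)%E].

Definition divergence_set (R : realType) (f : R -> R) (Lambda : set R)
    : set R :=
  [set x | translate_sum f Lambda x = +oo%E].

Definition type1 (R : realType) (Lambda : set R) : Prop :=
  admissible Lambda /\
  forall f : R -> R,
    (forall x, 0 <= f x) -> lebesgue_measurable_fun f ->
    completed_lebesgue_measure (divergence_set f Lambda) = 0%E \/
    completed_lebesgue_measure (convergence_set f Lambda) = 0%E.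

Definition minkowski_sum (R : realType) (A B : set R) : set R :=
  [set x + y | x in A & y in B].

(* Main.v *)
Require Import Defs.
From mathcomp Require Import all_boot all_order all_algebra.
From mathcomp Require Import all_classical all_reals all_analysis.
From mathcomp Require Import finmap measurable_realfun ring lra.

(** For an indicator function the multiplicities of the representations
    [v = l + l'] do not matter: both summands are bounded below and locally
    finite, so each [v] has finitely many representations, and finitely many
    [v] satisfy [x + v \in U] if and only if finitely many pairs [(l, l')]
    satisfy [x + l + l' \in U].  This settles the theorem for indicators
    ([minkowski_sum_indicator]).  If [\1_U] converges over the sum set on a
    set of positive measure, then it converges over [Lambda'] on a translate
    of that set, hence almost everywhere because [Lambda'] is type 1.  So
    [g x], the number of [l'] with [x + l' \in U], is a legitimate test
    function for [Lambda], and its convergence and divergence sets agree, up to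
    null sets, with those of [\1_U] over the sum set.

    For a general function the multiplicities do matter, and the substance of
    the proof is that type 1 may be tested on indicators of Borel sets only
    ([type1_of_indicators]): from [f] with convergence and divergence sets of
    positive measure one builds a Borel set [U] with the same property.  The
    heuristic is to draw [U] at random, putting [y] in [U] independently with
    probability [1 - exp (- f y)].  Over a finite range of translates, the
    expected number of hits [x + l \in U] is at most the sum of [f (x + l)],
    while the probability of no hit is [exp (- \sum f (x + l))].  So far out a
    point of convergence is unlikely to be hit, a point of divergence is likely
    to be hit, and Borel-Cantelli finishes ([indicator_witness]).

    The random choice is replaced by an extremal argument.  The integral of
    [cost], which adds the expected number of hits on [A] to the probability
    of no hit from [B], is an affine function of the restriction of the density
    to an interval so short that each [x] has at most one translate in it.  An
    affine function of a [0, 1]-valued density is minimised by an indicator, so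
    the density can be rounded on that interval without raising the cost
    ([round_piece]); repeating this on consecutive intervals turns the whole
    density into an indicator ([round_interval]). *)

Set Implicit Arguments.
Unset Strict Implicit.
Unset Printing Implicit Defensive.
Import Order.TTheory GRing.Theory Num.Theory.
Import numFieldNormedType.Exports.
Local Open Scope classical_set_scope.
Local Open Scope ring_scope.

(** * Translations of the line *)

Lemma measurable_shift (R : realType) (c : R) :
  measurable_fun [set: measurableTypeR R]
    (fun x : measurableTypeR R => (x + c)%R : measurableTypeR R).
Proof. exact: measurable_realfun.measurable_funD. Qed.

Lemma lebesgue_measure_shift (R : realType) (c : R) (A : set R) :
  measurable A -> lebesgue_measure [set x | A (x + c)] = lebesgue_measure A.
Proof.
move=> mA; symmetry.
pose m : {measure set _ -> \bar R} :=
  [the measure _ _ of pushforward (@lebesgue_measure R)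
     (fun x : measurableTypeR R => (x + c)%R : measurableTypeR R)].
rewrite (@lebesgue_measure_unique _ (m (@measurable_shift R c)))//.
move=> _ [[a b] _ <-] /=; rewrite /pushforward.
rewrite [X in _ = lebesgue_measure X](_ : _ = `]a - c, b - c]%classic); last first.
  by apply/seteqP; split => x /=; rewrite !in_itv/= ltrBlDr lerBrDr.
rewrite !lebesgue_measure_itv/= !lte_fin ltrD2r; case: ifP => // _.
by rewrite -!EFinB; congr (_%:E); ring.
Qed.

Lemma integral_shift (R : realType) (c : R) (h : R -> \bar R) :
  measurable_fun [set: R] h -> (forall x, 0 <= h x)%E ->
  (\int[@lebesgue_measure R]_x h (x + c)%R = \int[@lebesgue_measure R]_x h x)%E.
Proof.
move=> mh h0.
have -> : (\int[@lebesgue_measure R]_x h (x + c)%R =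
    \int[pushforward (@lebesgue_measure R)
      (fun x : measurableTypeR R => (x + c)%R : measurableTypeR R)]_x h x)%E.
  by rewrite (@ge0_integral_pushforward _ _ (measurableTypeR R)
    (measurableTypeR R) R _ (@measurable_shift R c) (@lebesgue_measure R)
    setT h).
pose m : {measure set _ -> \bar R} :=
  [the measure _ _ of pushforward (@lebesgue_measure R)
     (fun x : measurableTypeR R => (x + c)%R : measurableTypeR R)].
apply: (@eq_measure_integral _ _ _ _ lebesgue_measure (m (@measurable_shift R c))).
by move=> A mA _; exact: (lebesgue_measure_shift c mA).
Qed.

Section basics.
Variable R : realType.
Notation mu := (@lebesgue_measure R).
Implicit Types (f g h p w : R -> R) (A B J : set R).

Lemma indic_in A x : A x -> \1_A x = 1 :> R.
Proof. by move=> Ax; rewrite indicE mem_set. Qed.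

Lemma indic_notin A x : ~ A x -> \1_A x = 0 :> R.
Proof. by move=> Ax; rewrite indicE memNset. Qed.

Lemma indic_setC_notin A x : A x -> \1_(~` A) x = 0 :> R.
Proof. by move=> Ax; apply: indic_notin => /(_ Ax). Qed.

Lemma measurable_comp_shift f c :
  measurable_fun [set: R] f -> measurable_fun [set: R] (fun x => f (x + c)).
Proof. by move=> mf; apply: (measurableT_comp mf) => //; exact: measurable_shift. Qed.

Lemma ge0_integralD_EFin f g : measurable_fun [set: R] f ->
  measurable_fun [set: R] g -> (forall x, 0 <= f x) -> (forall x, 0 <= g x) ->
  (\int[mu]_x (f x + g x)%:E = \int[mu]_x (f x)%:E + \int[mu]_x (g x)%:E)%E.
Proof.
move=> mf mg f0 g0; under eq_integral do rewrite EFinD.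
by rewrite ge0_integralD//; try exact/measurable_EFinP; move=> x _; rewrite lee_fin.
Qed.

Lemma integral_sum_shift n (c : 'I_n -> R) (h : 'I_n -> R -> R) :
  (forall i, measurable_fun [set: R] (h i)) -> (forall i x, 0 <= h i x) ->
  (\int[mu]_x (\sum_(i < n) h i x)%:E =
   \int[mu]_x (\sum_(i < n) h i (x + c i))%:E)%E.
Proof.
move=> mh h0.
under eq_integral do rewrite -sumEFin.
under [RHS]eq_integral do rewrite -sumEFin.
have mEh i : measurable_fun [set: R] (fun x => (h i x)%:E) by exact/measurable_EFinP.
have mEs i : measurable_fun [set: R] (fun x => (h i (x + c i))%:E).
  by apply/measurable_EFinP; exact: measurable_comp_shift.
rewrite !(@ge0_integral_sum _ (measurableTypeR R) _ mu)//; last 2 first.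
- by move=> i x _; rewrite lee_fin.
- by move=> i x _; rewrite lee_fin.
apply: eq_bigr => i _; rewrite (@integral_shift R (c i) (fun x => (h i x)%:E))//.
by move=> x; rewrite lee_fin.
Qed.

End basics.

(** Translations are tried before indicators, as a translated indicator also
    unifies with the indicator of an unknown translated set. *)
Ltac mfun := repeat first
  [ assumption
  | apply: measurable_cst
  | apply: measurable_comp_shift
  | apply: measurable_indic
  | apply: measurable_realfun.measurable_funB
  | apply: measurable_realfun.measurable_funD
  | apply: measurable_realfun.measurable_funM
  | apply: measurable_sum => ?
  | apply: measurable_prod => ? _ ].

(** * Rounding a function to an indicator *)

Section rounding.
Variable R : realType.
Notation mu := (@lebesgue_measure R).
Variables (e : nat -> R) (A B : set R) (n m : nat).
Hypotheses (mA : measurable A) (mB : measurable B).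
Implicit Types (f g h p w : R -> R) (J : set R).

(** If [U] contains each [y] independently with probability [w y], this is,
    for [x] in [A], the expected number of hits [x + e i \in U] with [i < m],
    plus, for [x] in [B], the probability that no [x + e i] with [i < n] is
    in [U]. *)
Definition cost (w : R -> R) (x : R) : R :=
  \1_A x * \sum_(i < m) w (x + e i) + \1_B x * \prod_(i < n) (1 - w (x + e i)).

Lemma measurable_cost w : measurable_fun [set: R] w ->
  measurable_fun [set: R] (cost w).
Proof. by move=> mw; rewrite /cost; mfun. Qed.

(** Since at most one of the points [x + e i] lies in [J], the product has at
    most one factor that depends on the values of [w] on [J]; this makes the
    cost affine in them. *)
Lemma cost_split p w J :
  (forall x, ~ J x -> w x = p x) ->
  (forall (i j : 'I_n) x, J (x + e i) -> J (x + e j) -> i = j) ->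
  forall x, cost w x =
  (\1_A x * \sum_(i < m) (\1_(~` J) (x + e i) * p (x + e i)) +
   \1_B x * \prod_(i < n) (\1_(~` J) (x + e i) * (1 - p (x + e i)))) +
  (\sum_(i < m) (\1_A x * (\1_J (x + e i) * w (x + e i))) +
   \sum_(i < n) (\1_B x * \1_J (x + e i) * (1 - w (x + e i)) *
     \prod_(j < n | j != i) (1 - p (x + e j)))).
Proof.
move=> wp Jsep x; rewrite /cost addrACA; congr (_ + _).
  rewrite -mulr_sumr -mulrDr -big_split/=; congr (_ * _).
  apply: eq_bigr => i _; have [Jx|Jx] := pselect (J (x + e i)).
    by rewrite (indic_in Jx) (indic_setC_notin Jx) mul0r mul1r add0r.
  by rewrite (indic_notin Jx) indic_in// mul1r mul0r addr0 wp.
have [[i Ji]|nJ] := pselect (exists i : 'I_n, J (x + e i)).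
  rewrite [X in _ * X + _](bigD1 i)//= (indic_setC_notin Ji) !(mul0r, mulr0) add0r.
  rewrite [RHS](bigD1 i)//= [X in _ + X]big1 ?addr0.
    rewrite (bigD1 i)//= mulrA (indic_in Ji) mulr1; congr (_ * _).
    apply: eq_bigr => j ji; rewrite wp// => Jj.
    by rewrite (Jsep j i x Jj Ji) eqxx in ji.
  move=> j ji; rewrite (@indic_notin _ J) ?(mulr0, mul0r)// => Jj.
  by rewrite (Jsep j i x Jj Ji) eqxx in ji.
rewrite [X in _ = _ + X]big1 ?addr0.
  congr (_ * _); apply: eq_bigr => i _.
  have Ji : ~ J (x + e i) by move=> Ji; apply: nJ; exists i.
  by rewrite wp// indic_in// mul1r.
move=> i _; rewrite (@indic_notin _ J) ?(mulr0, mul0r)// => Ji.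
by apply: nJ; exists i.
Qed.

(** Translating each term of [cost_split] by its own [e i] turns the cost into
    a constant plus the integral over [J] of [w P + (1 - w) Q], where [P] and
    [Q] do not depend on [w] on [J].  The integrand is at least the minimum of
    [P] and [Q], which the indicator of [P < Q] attains. *)
Lemma round_piece p J : measurable_fun [set: R] p -> (forall x, 0 <= p x <= 1) ->
  measurable J ->
  (forall (i j : 'I_n) x, J (x + e i) -> J (x + e j) -> i = j) ->
  exists g, [/\ measurable_fun [set: R] g, forall x, 0 <= g x <= 1,
    forall x, ~ J x -> g x = p x, forall x, J x -> g x = 0 \/ g x = 1 &
    (\int[mu]_x (cost g x)%:E <= \int[mu]_x (cost p x)%:E)%E].
Proof.
move=> mp p01 mJ Jsep.
pose q (i : 'I_n) x := \prod_(j < n | j != i) (1 - p (x + e j)).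
have q0 i x : 0 <= q i x.
  by apply: prodr_ge0 => j _; rewrite subr_ge0; case/andP: (p01 (x + e j)).
have mq i : measurable_fun [set: R] (q i).
  have -> : q i = fun x => \prod_(j < n) if j != i then 1 - p (x + e j) else 1.
    by apply/funext => x; rewrite /q big_mkcond.
  by apply: measurable_prod => j _; case: (j != i); mfun.
(* [P] is the price of putting [y] into [U], [Q] that of leaving it out. *)
pose P y := \sum_(i < m) \1_A (y - e i) : R.
pose Q y := \sum_(i < n) \1_B (y - e i) * q i (y - e i) : R.
have mP : measurable_fun [set: R] P by rewrite /P; mfun.
have mQ : measurable_fun [set: R] Q.
  rewrite /Q; apply: measurable_sum => i.
  apply: measurable_realfun.measurable_funM; last exact: measurable_comp_shift.
  by mfun.
pose V := [set y | P y < Q y].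
have mV : measurable V.
  have := measurable_fun_ltr mP mQ => /(_ measurableT [set true] I).
  by rewrite setTI.
pose g y := \1_J y * \1_V y + \1_(~` J) y * p y : R.
have mg : measurable_fun [set: R] g.
  by rewrite /g; mfun; exact: measurableC.
have gJ x : J x -> g x = \1_V x.
  by move=> Jx; rewrite /g (indic_in Jx) (indic_setC_notin Jx) mul0r mul1r addr0.
have gNJ x : ~ J x -> g x = p x.
  by move=> Jx; rewrite /g (indic_notin Jx) (@indic_in _ (~` J))// mul0r mul1r add0r.
have V01 x : \1_V x = 0 :> R \/ \1_V x = 1 :> R.
  by rewrite indicE; case: (x \in V); [right|left].
have g01 x : 0 <= g x <= 1.
  have [Jx|Jx] := pselect (J x); last by rewrite gNJ.
  by rewrite gJ//; case: (V01 x) => ->; rewrite ?lexx ler01.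
exists g; split => //.
  by move=> x Jx; rewrite gJ//; exact: V01.
pose k x := \1_A x * \sum_(i < m) (\1_(~` J) (x + e i) * p (x + e i)) +
   \1_B x * \prod_(i < n) (\1_(~` J) (x + e i) * (1 - p (x + e i))).
have mCJ := measurableC mJ.
have mk : measurable_fun [set: R] k by rewrite /k; mfun.
have i0 (S : set R) x : 0 <= \1_S x :> R by rewrite indicE.
have k0 x : 0 <= k x.
  rewrite /k addr_ge0// mulr_ge0//.
    by apply: sumr_ge0 => i _; rewrite mulr_ge0//; case/andP: (p01 (x + e i)).
  by apply: prodr_ge0 => i _; rewrite mulr_ge0// subr_ge0; case/andP: (p01 (x + e i)).
(* It suffices to see the cost of a density [w] agreeing with [p] off [J] as
   an integral over [J] in which [w] enters linearly. *)
suff H w : measurable_fun [set: R] w -> (forall x, 0 <= w x <= 1) ->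
    (forall x, ~ J x -> w x = p x) ->
    (\int[mu]_x (cost w x)%:E = \int[mu]_x (k x)%:E +
     \int[mu]_x (\1_J x * (w x * P x + (1 - w x) * Q x))%:E)%E.
  rewrite H// [leRHS]H//; apply: leeD2l.
  have P0 y : 0 <= P y by apply: sumr_ge0.
  have Q0 y : 0 <= Q y by apply: sumr_ge0 => i _; exact: mulr_ge0.
  apply: ge0_le_integral => //.
  - move=> x _; rewrite lee_fin mulr_ge0//.
    by case/andP: (g01 x) => ? ?; rewrite addr_ge0// mulr_ge0// subr_ge0.
  - by apply/measurable_EFinP; mfun.
  - by apply/measurable_EFinP; mfun.
  move=> x _; rewrite lee_fin ler_wpM2l//.
  have [Jx|Jx] := pselect (J x); last by rewrite gNJ.
  rewrite gJ//.
  case/andP: (p01 x) => px0 px1.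
  have [PQ|PQ] := pselect (V x); move: (PQ); rewrite /V/=.
    by rewrite indic_in// mul1r subrr mul0r addr0; nra.
  by move/negP; rewrite -leNgt indic_notin// mul0r subr0 add0r mul1r; nra.
move=> mw w01 wp.
under eq_integral do rewrite (cost_split wp Jsep).
under eq_integral do rewrite -/(k _).
pose hA (i : 'I_m) x := \1_A x * (\1_J (x + e i) * w (x + e i)) : R.
pose hB (i : 'I_n) x := \1_B x * \1_J (x + e i) * (1 - w (x + e i)) * q i x : R.
have w0 x : 0 <= w x by case/andP: (w01 x).
have w1 x : 0 <= 1 - w x by rewrite subr_ge0; case/andP: (w01 x).
have mhA i : measurable_fun [set: R] (hA i) by rewrite /hA; mfun.
have mhB i : measurable_fun [set: R] (hB i).
  by apply: measurable_realfun.measurable_funM => //; mfun.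
have hA0 i x : 0 <= hA i x by rewrite /hA !mulr_ge0.
have hB0 i x : 0 <= hB i x by rewrite /hB !mulr_ge0.
have shA0 x : 0 <= \sum_(i < m) hA i x by exact: sumr_ge0.
have shB0 x : 0 <= \sum_(i < n) hB i x by exact: sumr_ge0.
have mshA : measurable_fun [set: R] (fun x => \sum_(i < m) hA i x).
  exact: measurable_sum.
have mshB : measurable_fun [set: R] (fun x => \sum_(i < n) hB i x).
  exact: measurable_sum.
rewrite (@ge0_integralD_EFin _ k
  (fun x => \sum_(i < m) hA i x + \sum_(i < n) hB i x))//; last 2 first.
- exact: measurable_realfun.measurable_funD.
- by move=> x; exact: addr_ge0.
congr (_ + _)%E.
rewrite ge0_integralD_EFin//.
rewrite (integral_sum_shift (fun i => - e i))//.
rewrite (integral_sum_shift (fun i => - e i) mhB)//.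
rewrite -ge0_integralD_EFin//; last 4 first.
- by apply: measurable_sum => i; exact: measurable_comp_shift.
- by apply: measurable_sum => i; exact: measurable_comp_shift.
- by move=> x; exact: sumr_ge0.
- by move=> x; exact: sumr_ge0.
apply: eq_integral => y _; congr (_%:E).
rewrite mulrDr /P /Q !mulr_sumr; congr (_ + _); apply: eq_bigr => i _.
  by rewrite /hA subrK; ring.
by rewrite /hB subrK; ring.
Qed.
End rounding.

Section rounding_interval.
Variable R : realType.
Notation mu := (@lebesgue_measure R).
Variables (e : nat -> R) (A B : set R).
Hypotheses (inje : injective e) (mA : measurable A) (mB : measurable B).
Implicit Types (f g h p w : R -> R) (J : set R).

Lemma exists_gap n : exists2 d : R, 0 < d &
  forall i j : 'I_n, `|e i - e j| < d -> i = j.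
Proof.
pose gap (ij : 'I_n * 'I_n) := if ij.1 == ij.2 then 1 else `|e ij.1 - e ij.2|.
pose d := \big[Num.min/1]_(ij : 'I_n * 'I_n) gap ij.
exists d.
  rewrite /d; elim/big_ind : _ => // [x y x0 y0|[i j] _]; first by rewrite lt_min x0.
  rewrite /gap/=; case: eqP => // ij; rewrite normr_gt0 subr_eq0.
  by apply/eqP => /inje /val_inj.
move=> i j; rewrite ltNge; apply: contraNeq => /eqP ij.
have : d <= gap (i, j) by exact: bigmin_le_cond.
by rewrite /gap/=; case: eqP.
Qed.

(** The gap [d] between the first [n] translations makes [round_piece]
    applicable to any interval of length [d]. *)
Lemma round_interval n m d : 0 < d ->
  (forall i j : 'I_n, `|e i - e j| < d -> i = j) ->
  forall p T k, measurable_fun [set: R] p -> (forall x, 0 <= p x <= 1) ->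
  exists g, [/\ measurable_fun [set: R] g, forall x, 0 <= g x <= 1,
    forall x, ~ (T <= x < T + k%:R * d) -> g x = p x,
    forall x, T <= x < T + k%:R * d -> g x = 0 \/ g x = 1 &
    (\int[mu]_x (cost e A B n m g x)%:E <= \int[mu]_x (cost e A B n m p x)%:E)%E].
Proof.
move=> d0 dsep p T k mp p01; elim: k => [|k [g [mg g01 gout gin cg]]].
  exists p; split => //; move=> x.
  by rewrite mul0r addr0 => /andP[a /(le_lt_trans a)]; rewrite ltxx.
pose J : set R := `[T + k%:R * d, T + k.+1%:R * d[%classic.
have kd : k.+1%:R * d = k%:R * d + d by rewrite -natr1 mulrDl mul1r.
have [] := @round_piece R e A B n m mA mB g J mg g01.
- exact: measurable_itv.
- move=> i j x; rewrite /J/= !in_itv/= kd => /andP[i1 i2] /andP[j1 j2].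
  by apply: dsep; rewrite ltr_norml; apply/andP; split; lra.
move=> g' [mg' g'01 g'out g'in cg']; exists g'; split => //.
- move=> x nx; rewrite g'out ?gout//.
    by move=> /andP[a b]; apply: nx; rewrite kd a/=; lra.
  rewrite /J/= in_itv/= => /andP[a b]; apply: nx; rewrite b andbT.
  by apply: le_trans a; rewrite lerDl mulr_ge0// ltW.
- move=> x /andP[a b]; have [c|c] := leP (T + k%:R * d) x.
    by apply: g'in; rewrite /J/= in_itv/= c b.
  rewrite g'out; first by apply: gin; rewrite a c.
  by rewrite /J/= in_itv/= leNgt c.
exact: le_trans cg' cg.
Qed.

End rounding_interval.

(** * An indicator with the convergence behaviour of a given function *)

Section block.
Variable R : realType.
Notation mu := (@lebesgue_measure R).
Implicit Types (f g h p w : R -> R) (J : set R).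

Lemma finite_set_nat_ubound (X : set nat) :
  finite_set X -> exists N, forall i, X i -> (i < N)%N.
Proof.
move=> finX; exists (\max_(i <- fset_set X) i).+1 => i Xi.
rewrite ltnS; apply: (@leq_bigmax_seq _ _ xpredT id) => //.
by rewrite in_fset_set//; exact: mem_set.
Qed.

Lemma nneseries_pinfty_ge (u : nat -> R) : (forall i, 0 <= u i) ->
  (\sum_(0 <= i <oo) (u i)%:E = +oo)%E ->
  forall L, \forall n \near \oo, L <= \sum_(i < n) u i.
Proof.
move=> u0 uoo L.
have : (fun n => \sum_(0 <= i < n) (u i)%:E)%E @ \oo --> +oo%E.
  by rewrite -uoo; apply: is_cvg_nneseries => i _ _; rewrite lee_fin.
move/cvgey_ge => /(_ L); apply: filterS => n.
by rewrite sumEFin lee_fin big_mkord.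
Qed.

Lemma measurable_nneseries (h : nat -> R -> R) : (forall i x, 0 <= h i x) ->
  (forall i, measurable_fun [set: R] (h i)) ->
  measurable_fun [set: R] (fun x => \sum_(0 <= i <oo) (h i x)%:E)%E.
Proof.
move=> h0 mh.
apply: (@ge0_emeasurable_sum _ _ _ _ (fun i x => (h i x)%:E) xpredT) => i.
  by move=> x _ _; rewrite lee_fin.
by move=> _; exact/measurable_EFinP.
Qed.

Variables (e : nat -> R) (f : R -> R) (A B : set R) (K M : R).
Hypotheses (inje : injective e)
  (e_oo : forall t, exists N, forall i, (N <= i)%N -> t < e i).
Hypotheses (mf : measurable_fun [set: R] f) (f0 : forall x, 0 <= f x).
Hypotheses (mA : measurable A) (mB : measurable B).
Hypotheses (AK : forall x, A x -> `|x| <= K) (BK : forall x, B x -> `|x| <= K).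
Hypotheses
  (fA : forall x, A x -> (\sum_(0 <= i <oo) (f (x + e i))%:E <= M%:E)%E)
  (fB : forall x, B x -> (\sum_(0 <= i <oo) (f (x + e i))%:E = +oo)%E).

Lemma bounded_measure_lty (S : set R) : (forall x, S x -> `|x| <= K) ->
  (mu S < +oo)%E.
Proof.
move=> SK; apply: (@le_lt_trans _ _ (mu `[-K, K]%classic)).
  apply: le_outer_measure => x /SK.
  by rewrite /= in_itv/= ler_norml.
by rewrite /= lebesgue_measure_itv/=; case: ifP => _; rewrite ?ltry// -EFinB ltry.
Qed.

(** The series has a bounded sum on the bounded set [A], so it has a finite
    integral there and the tails of its integral tend to zero. *)
Lemma convergent_tail_small (eps : R) : 0 < eps -> exists N, forall m,
  (\int[mu]_x (\sum_(N <= i < m) \1_A x * f (x + e i))%:E <= eps%:E)%E.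
Proof.
move=> eps0.
pose a i := (\int[mu]_x (\1_A x * f (x + e i))%:E)%E.
have h0 i x : 0 <= \1_A x * f (x + e i) by rewrite mulr_ge0.
have mh i : measurable_fun [set: R] (fun x => \1_A x * f (x + e i)) by mfun.
have mhE i : measurable_fun [set: R] (fun x => (\1_A x * f (x + e i))%:E).
  exact/measurable_EFinP.
have a0 i : (0 <= a i)%E by apply: integral_ge0 => x _; rewrite lee_fin.
have suma : (\sum_(0 <= i <oo) a i < +oo)%E.
  rewrite /a -integral_nneseries//; last by move=> *; rewrite lee_fin.
  apply: (@le_lt_trans _ _ (\int[mu]_x ((`|M|)%:E * (\1_A x)%:E)))%E.
    apply: ge0_le_integral => //.
    - by move=> x _; apply: nneseries_ge0 => *; rewrite lee_fin.
    - exact: measurable_nneseries.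
    - by apply: measurable_funeM; exact/measurable_EFinP/measurable_indic.
    move=> x _; have [Ax|Ax] := pselect (A x).
      rewrite indic_in// mule1; under eq_eseriesr do rewrite mul1r.
      by rewrite (le_trans (fA Ax))// lee_fin ler_norm.
    rewrite indic_notin// mule0; under eq_eseriesr do rewrite mul0r.
    by rewrite eseries0.
  rewrite ge0_integralZl//; last exact/measurable_EFinP/measurable_indic.
  by rewrite integral_indic// setIT lte_mul_pinfty// bounded_measure_lty.
have /fine_cvgP[fin_tail tail0] : (\sum_(N <= k <oo) a k)%E @[N --> \oo] --> 0%:E.
  exact: nneseries_tail_cvg suma (fun i _ => a0 i).
have [N _ HN] : \forall N \near \oo, (\sum_(N <= k <oo) a k < eps%:E)%E.
  have lt0 : \forall N \near \oo, fine (\sum_(N <= k <oo) a k)%E < eps.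
    exact: (cvgr_lt (0 : R) tail0).
  by apply: filterS2 fin_tail lt0 => N finN ltN; rewrite -(fineK finN) lte_fin.
exists N => m; under eq_integral do rewrite -sumEFin.
rewrite (@ge0_integral_sum _ (measurableTypeR R) _ mu)//.
  apply: le_trans (ltW (HN N (leqnn N))).
  exact: (nneseries_lim_ge m (fun n _ _ => a0 n)).
by move=> i x _; rewrite lee_fin.
Qed.

(** On [B] the series still diverges after [f] is cut off below [T], because
    only finitely many translates are affected; so the exponentials decrease
    to zero and dominated convergence applies. *)
Lemma divergent_survival_small T eps : 0 < eps -> exists n,
  (\int[mu]_x (\1_B x *
     expR (- \sum_(i < n) (f (x + e i) * \1_`[T, +oo[ (x + e i))))%:E
   <= eps%:E)%E.
Proof.
move=> eps0.
pose u x i := f (x + e i) * \1_`[T, +oo[ (x + e i) : R.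
have u0 x i : 0 <= u x i by rewrite mulr_ge0.
pose F n x := (\1_B x * expR (- \sum_(i < n) u x i))%:E.
have mF n : measurable_fun [set: R] (F n).
  apply/measurable_EFinP; apply: measurable_realfun.measurable_funM.
    exact: measurable_indic.
  apply: measurableT_comp => //; apply: measurableT_comp => //.
  by rewrite /u; mfun; exact: measurable_itv.
have uoo x : B x -> (\sum_(0 <= i <oo) (u x i)%:E = +oo)%E.
  move=> Bx; have [N HN] := e_oo (T + K).
  rewrite (@nneseries_split _ _ 0 N); last by move=> *; rewrite lee_fin.
  have -> : (\sum_(0 + N <= i <oo) (u x i)%:E =
             \sum_(0 + N <= i <oo) (f (x + e i))%:E)%E.
    apply/congr_lim/funext => n; apply: eq_big_nat => i /andP[Ni _].
    rewrite /u indic_in ?mulr1//= in_itv/= andbT; have := HN i Ni; have := BK Bx.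
    by rewrite ler_norml => /andP[? ?] ?; lra.
  have := fB Bx.
  rewrite (@nneseries_split _ _ 0 N); last by move=> *; rewrite lee_fin.
  by rewrite !sumEFin; case: (\sum_(_ <= i <oo) _)%E.
have cvF x : F ^~ x @ \oo --> 0%E.
  have [Bx|Bx] := pselect (B x); last first.
    rewrite (_ : F ^~ x = fun=> 0%E); first exact: cvg_cst.
    by apply/funext => n; rewrite /F indic_notin// mul0r.
  apply: cvg_EFin; first by apply: nearW.
  rewrite (_ : fine \o _ =
    (fun y => expR (- y)) \o (fun n => \sum_(i < n) u x i)); last first.
    by apply/funext => n /=; rewrite indic_in// mul1r.
  apply: cvg_comp (@cvgr_expR R).
  by apply/cvgryPge => L; exact: (nneseries_pinfty_ge (u0 x) (uoo x Bx)).
have [] := @dominated_convergence _ _ _ mu _ measurableT F (cst 0%E)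
  (fun x => (\1_B x)%:E) mF.
- exact: measurable_cst.
- by apply: aeW => x _.
- apply/integrableP; split; first exact/measurable_EFinP/measurable_indic.
  under eq_integral do rewrite /= ger0_norm//.
  by rewrite integral_indic// setIT bounded_measure_lty.
- apply: aeW => x n _; rewrite /F/= lee_fin ger0_norm ?mulr_ge0// ?expR_ge0//.
  by rewrite ler_piMr// -expR0 ler_expR oppr_le0 sumr_ge0.
move=> _ _; rewrite integral0 => /fine_cvgP[fin_I I0].
have [n _ Hn] : \forall n \near \oo, (\int[mu]_x F n x < eps%:E)%E.
  have lt0 : \forall n \near \oo, fine (\int[mu]_x F n x)%E < eps.
    exact: (cvgr_lt (0 : R) I0).
  apply: filterS2 fin_I lt0 => n finn ltn.
  by rewrite -(@fineK _ (\int[mu]_x F n x)%E finn) lte_fin.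
by exists n; exact: (ltW (Hn n (leqnn n))).
Qed.

Definition hits (U : set R) : set R := [set x | exists i, U (x + e i)].

Lemma measurable_hits U : measurable U -> measurable (hits U).
Proof.
move=> mU; rewrite (_ : hits U = \bigcup_i [set x | U (x + e i)]).
  apply: bigcupT_measurable => i.
  by have := measurable_shift (e i) measurableT mU; rewrite setTI.
by apply/seteqP; split => x [i]; [exists i|move=> _ ?; exists i].
Qed.

Lemma translates_ubound n : exists c, forall i, (i < n)%N -> e i <= c.
Proof.
elim: n => [|n [c cP]]; first by exists 0.
exists (Num.max c (e n)) => i; rewrite ltnS leq_eqVlt => /predU1P[->|/cP ic].
  by rewrite le_max lexx orbT.
by rewrite le_max ic.
Qed.

(** The density [1 - expR (- f)], restricted to a window far to the right, has
    small cost: on [A] it is bounded by [f], and on [B] the product of its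
    complements is the exponential of minus the sum of [f].  The set that
    results from rounding has no larger cost, and its cost is at least [1] at
    each point of [A] with a hit and at each point of [B] without one. *)
Lemma bounded_block T eps : 0 < eps -> exists U T', [/\ measurable (U : set R),
  (forall y, U y -> T <= y < T'),
  (mu (A `&` hits U) <= eps%:E)%E & (mu (B `&` ~` hits U) <= eps%:E)%E].
Proof.
move=> eps0; have eps20 : 0 < eps / 2 by rewrite divr_gt0.
have [N HN] := convergent_tail_small eps20.
have [c cP] := translates_ubound N.
(* Right of [T0] the first [N] translates of a point of [A] do not occur. *)
pose T0 := Num.max T (K + c + 1).
have T0e i x : (i < N)%N -> A x -> x + e i < T0.
  move=> /cP ic /AK; rewrite ler_norml => /andP[_ xK].
  by rewrite lt_max; apply/orP; right; lra.
have [n Hn] := divergent_survival_small T0 eps20.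
have [d d0 dsep] := exists_gap inje n.
have [c' c'P] := translates_ubound n.
(* The window is a whole number of intervals of length [d], and reaches beyond
   the first [n] translates of every point of [B]. *)
pose k := (Num.truncn ((K + c' - T0) / d)).+1.
pose T1 := T0 + k%:R * d.
have T1e i x : (i < n)%N -> B x -> x + e i < T1.
  move=> /c'P ic /BK; rewrite ler_norml => /andP[_ xK].
  have : (K + c' - T0) / d < k%:R by exact: truncnS_gt.
  by rewrite ltr_pdivrMr// /T1; lra.
(* Only the first [m] translates of a point of [A] can fall in the window. *)
have [m0 m0P] := e_oo (T1 + K).
pose m := maxn m0 N.
have mP i : (m <= i)%N -> T1 + K < e i.
  by rewrite geq_max => /andP[/m0P].
have mT1 i x : A x -> x + e i < T1 -> (i < m)%N.
  move=> /AK; rewrite ler_norml => /andP[xK _] xe.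
  by rewrite ltnNge; apply/negP => /mP; lra.
pose J : set R := `[T0, T1[%classic.
have mJ : measurable J by exact: measurable_itv.
pose p x := \1_J x * (1 - expR (- f x)).
have e01 x : 0 <= 1 - expR (- f x) <= 1.
  by rewrite subr_ge0 lerBlDr lerDl expR_ge0 andbT -expR0 ler_expR oppr_le0.
have p01 x : 0 <= p x <= 1.
  have [Jx|Jx] := pselect (J x); first by rewrite /p indic_in// mul1r.
  by rewrite /p indic_notin// mul0r lexx ler01.
have mp : measurable_fun [set: R] p.
  rewrite /p; mfun.
  by apply: measurableT_comp => //; apply: measurableT_comp.
have [g [mg g01 gout gin cg]] := round_interval mA mB m d0 dsep T0 k mp p01.
have cost0 w x : (forall x, 0 <= w x <= 1) ->
    0 <= \1_A x * \sum_(i < m) w (x + e i) /\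
    0 <= \1_B x * \prod_(i < n) (1 - w (x + e i)).
  move=> w01; split; rewrite mulr_ge0//.
    by apply: sumr_ge0 => i _; case/andP: (w01 (x + e i)).
  by apply: prodr_ge0 => i _; rewrite subr_ge0; case/andP: (w01 (x + e i)).
have costp : (\int[mu]_x (cost e A B n m p x)%:E <= eps%:E)%E.
  rewrite /cost ge0_integralD_EFin; last 4 first.
  - by mfun.
  - by mfun.
  - by move=> x; case: (cost0 p x p01).
  - by move=> x; case: (cost0 p x p01).
  rewrite [leRHS](_ : _ = ((eps / 2)%:E + (eps / 2)%:E)%E); last first.
    by rewrite -EFinD; congr (_%:E); lra.
  apply: leeD.
    apply: le_trans (HN m); apply: ge0_le_integral => //.
    - by move=> x _; rewrite lee_fin; case: (cost0 p x p01).
    - by apply/measurable_EFinP; mfun.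
    - by apply/measurable_EFinP; mfun.
    move=> x _; rewrite lee_fin -mulr_sumr.
    have [Ax|Ax] := pselect (A x); last by rewrite indic_notin// !mul0r.
    rewrite indic_in// !mul1r -(big_mkord xpredT (fun i => p (x + e i))).
    rewrite (@big_cat_nat _ _ _ N)//=; last by rewrite leq_maxr.
    rewrite big_nat big1 ?add0r; last first.
      move=> i /andP[_ iN]; rewrite /p indic_notin ?mul0r// /J/= in_itv/=.
      by rewrite leNgt (T0e _ _ iN Ax).
    apply: ler_sum => i _; rewrite /p.
    have [Jx|Jx] := pselect (J (x + e i)); last by rewrite indic_notin// mul0r.
    by rewrite indic_in// mul1r lerBlDr -lerBlDl; exact: expR_ge1Dx.
  apply: le_trans Hn; apply: ge0_le_integral => //.
  - by move=> x _; rewrite lee_fin; case: (cost0 p x p01).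
  - by apply/measurable_EFinP; mfun.
  - apply/measurable_EFinP; apply: measurable_realfun.measurable_funM.
      exact: measurable_indic.
    apply: measurableT_comp => //; apply: measurableT_comp => //.
    by mfun; exact: measurable_itv.
  move=> x _; rewrite lee_fin.
  have [Bx|Bx] := pselect (B x); last by rewrite indic_notin// !mul0r.
  rewrite indic_in// !mul1r -sumrN expR_sum; apply: ler_prod => i _.
  rewrite subr_ge0; case/andP: (p01 (x + e i)) => _ -> /=; rewrite /p.
  have xT1 : x + e i < T1 by apply: T1e.
  have [xT0|xT0] := leP T0 (x + e i).
    rewrite indic_in; last by rewrite /J/= in_itv/= xT0 xT1.
    rewrite indic_in; last by rewrite /= in_itv/= xT0.
    by rewrite mul1r mulr1 opprB addrC subrK.
  rewrite indic_notin; last by rewrite /J/= in_itv/= leNgt xT0.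
  rewrite indic_notin; last by rewrite /= in_itv/= leNgt xT0.
  by rewrite mul0r mulr0 subr0 oppr0 expR0.
pose U := [set y | g y = 1].
have mU : measurable U.
  rewrite (_ : U = g @^-1` [set 1])//.
  by have := mg measurableT _ (measurable_set1 (1 : R)); rewrite setTI.
have UJ y : U y -> T0 <= y < T1.
  move=> Uy; apply: contrapT => nJ; move: Uy; rewrite /U/= (gout _ nJ) /p indic_notin.
    by rewrite mul0r => /esym/eqP; rewrite oner_eq0.
  by rewrite /J/= in_itv.
have gU y : g y = \1_U y.
  have [Uy|Uy] := pselect (U y); first by rewrite indic_in.
  rewrite indic_notin//; have [Jy|Jy] := pselect (T0 <= y < T1).
    by case: (gin _ Jy).
  by rewrite (gout _ Jy) /p indic_notin ?mul0r// /J/= in_itv.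
have small S : measurable S -> (forall x, S x -> 1 <= cost e A B n m g x) ->
    (mu S <= eps%:E)%E.
  move=> mS Sg; rewrite -(setIT S) -integral_indic//.
  apply: le_trans (le_trans cg costp); apply: ge0_le_integral => //.
  - exact/measurable_EFinP/measurable_indic.
  - by apply/measurable_EFinP; exact: measurable_cost.
  move=> x _; rewrite lee_fin; have [Sx|Sx] := pselect (S x).
    by rewrite indic_in// Sg.
  by rewrite indic_notin//; case: (cost0 g x g01) => ? ?; exact: addr_ge0.
exists U, T1; split => //.
- by move=> y /UJ /andP[a ->]; rewrite andbT (le_trans _ a)// le_max lexx.
- apply: small => [|x [Ax [i Ui]]]; first exact: measurableI (measurable_hits mU).
  have im : (i < m)%N by apply: mT1 Ax _; case/andP: (UJ _ Ui).
  case: (cost0 g x g01) => _ ?; rewrite /cost -[leLHS]addr0 lerD//.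
  rewrite indic_in// mul1r (bigD1 (Ordinal im))//= gU indic_in// lerDl.
  by apply: sumr_ge0 => j _; case/andP: (g01 (x + e j)).
apply: small => [|x [Bx nU]].
  by apply: measurableI => //; apply: measurableC; exact: measurable_hits.
case: (cost0 g x g01) => ? _; rewrite /cost -[leLHS]add0r lerD//.
rewrite indic_in// mul1r big1// => i _; rewrite gU indic_notin ?subr0// => Ui.
by apply: nU; exists i.
Qed.

(** The union of the sets given by [bounded_block] with [T] and [eps] running
    through [n] and [2 ^- n.+1].  By Borel-Cantelli almost every point of [A]
    hits finitely many of these bounded sets, hence has finitely many hits,
    while almost every point of [B] hits all but finitely many of them; as they
    move off to infinity, this takes infinitely many hits. *)
Lemma indicator_witness : exists U : set R, [/\ measurable U,
  mu.-negligible (A `&` [set x | infinite_set [set i | U (x + e i)]]) &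
  mu.-negligible (B `&` [set x | finite_set [set i | U (x + e i)]])].
Proof.
have block n : exists UT : set R * R, [/\ measurable UT.1,
    (forall y, UT.1 y -> n%:R <= y < UT.2),
    (mu (A `&` hits UT.1) <= (1 / (2 ^ n.+1)%:R)%:E)%E &
    (mu (B `&` ~` hits UT.1) <= (1 / (2 ^ n.+1)%:R)%:E)%E].
  have [|U [T' H]] := @bounded_block n%:R (1 / (2 ^ n.+1)%:R).
    by rewrite divr_gt0// ltr0n expn_gt0.
  by exists (U, T').
have [UT UTP] := choice block; pose U n := (UT n).1.
have mU n : measurable (U n) by case: (UTP n).
have small_limsup (F : (set R)^nat) : (forall n, measurable (F n)) ->
    (forall n, (mu (F n) <= (1 / (2 ^ n.+1)%:R)%:E)%E) ->
    mu.-negligible (lim_sup_set F).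
  move=> mF leF.
  have mL : measurable (lim_sup_set F).
    by apply: bigcapT_measurable => n; apply: bigcup_measurable.
  exists (lim_sup_set F); split => //.
  apply: lim_sup_set_cvg0 => //.
  apply: (@le_lt_trans _ _ (\sum_(0 <= i <oo) (1 / (2 ^ i.+1)%:R)%:E)%E).
    by apply: lee_nneseries => *; [exact: measure_ge0|exact: leF].
  by apply: le_lt_trans (epsilon_trick0 xpredT _) _ => //; rewrite ltry.
have notlim (F : (set R)^nat) x :
    ~ lim_sup_set F x -> exists k, forall j, (k <= j)%N -> ~ F j x.
  move=> /existsNP[k /not_implyP[_ nk]]; exists k => j kj Fj.
  by apply: nk; exists j.
exists (\bigcup_n U n); split; first exact: bigcupT_measurable.
- apply: negligibleS (small_limsup (fun n => A `&` hits (U n)) _ _); last 2 first.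
  + by move=> n; apply: measurableI => //; exact: measurable_hits.
  + by move=> n; case: (UTP n).
  move=> x [Ax infx]; apply: contrapT => /notlim[k kP]; apply: infx.
  pose c := \big[Num.max/0]_(j < k) (UT j).2.
  have [N NP] := e_oo (c - x).
  apply: (sub_finite_set _ (finite_II N)) => i /= [j _ Uj].
  rewrite ltnNge; apply/negP => /NP; apply/negP; rewrite -leNgt.
  have [jk|kj] := ltnP j k; last by case: (kP j kj); split => //; exists i.
  have := le_bigmax 0 (fun j : 'I_k => (UT j).2) (Ordinal jk).
  by case: (UTP j) => _ /(_ _ Uj)/andP[_ ?] _ _; rewrite -/c/=; lra.
apply: negligibleS (small_limsup (fun n => B `&` ~` hits (U n)) _ _); last 2 first.
- by move=> n; apply: measurableI => //; apply: measurableC; exact: measurable_hits.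
- by move=> n; case: (UTP n).
move=> x [Bx finx]; apply: contrapT => /notlim[k kP].
have [N NP] : exists N, forall i, (\bigcup_n U n) (x + e i) -> (i < N)%N.
  exact: (finite_set_nat_ubound finx).
have [c cP] := translates_ubound N.
pose j := maxn k (Num.truncn (x + c)).+1.
apply: (kP j); first exact: leq_maxl.
split => // -[i Uji].
have iN : (i < N)%N by apply: NP; exists j.
have /andP[+ _] : j%:R <= x + e i < (UT j).2 by case: (UTP j) => _ /(_ _ Uji).
have : x + c < j%:R.
  by apply: lt_le_trans (truncnS_gt _) _; rewrite ler_nat leq_maxr.
by have := cP _ iN; lra.
Qed.

End block.

(** * Null sets and Borel representatives *)

Section null_sets.
Variable R : realType.
Notation mu := (@lebesgue_measure R).

Lemma completed_lebesgue_measure_eq0 (N : set R) :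
  completed_lebesgue_measure N = 0%E <-> mu.-negligible N.
Proof. by split=> [N0|/negligible_outer_measure//]; exact/negligible_outer_measure. Qed.

Lemma negligible_shift (N : set R) c :
  mu.-negligible N -> mu.-negligible [set x | N (x + c)].
Proof.
move=> [M [mM M0 NM]]; exists [set x | M (x + c)]; split.
- by have := measurable_shift c measurableT mM; rewrite setTI.
- by rewrite -[RHS]M0; exact: lebesgue_measure_shift.
by move=> x; exact: NM.
Qed.

(** Each superlevel set of [f] at a rational height is a Borel set up to a
    null set.  Countably many heights suffice, so the exceptional sets lie in
    one Borel null set [N], and [f] is Borel once it is set to zero on [N]. *)
Lemma lebesgue_measurable_ae_borel (f : R -> R) : (forall x, 0 <= f x) ->
  lebesgue_measurable_fun f ->
  exists g : R -> R, [/\ measurable_fun [set: R] g, forall x, 0 <= g x &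
    mu.-negligible [set x | f x <> g x]].
Proof.
move=> f0 mf.
have dec (q : rat) : exists AN : set R * set R, [/\ measurable AN.1,
    measurable AN.2, mu AN.2 = 0%E &
    forall x, ~ AN.2 x -> (ratr q < f x) = (x \in AN.1)].
  have : (completed_algebra_gen mu) (f @^-1` `]ratr q, +oo[%classic).
    rewrite -g_sigma_completed_algebra_genE completed_caratheodory_measurable.
    have := mf measurableT _ (measurable_itv (`]ratr q, +oo[ : interval R)).
    by rewrite setTI.
  move=> [A mA [M [N [mN N0 MN]] AMf]]; exists (A, N); split => //= x Nx.
  apply/idP/idP => [fx|/set_mem Ax].
    have : (f @^-1` `]ratr q, +oo[%classic) x by rewrite /= in_itv/= fx.
    by rewrite -AMf => -[/mem_set//|/MN].
  have : (A `|` M) x by left.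
  by rewrite AMf /= in_itv/= andbT.
have {dec} /choice[AN ANP] := dec.
(* An enumeration of the rationals, with repetitions of [0]. *)
pose q i : rat := odflt 0 (choice.unpickle i).
pose N := \bigcup_i (AN (q i)).2.
have mN : measurable N by apply: bigcupT_measurable => i; case: (ANP (q i)).
have N0 : mu N = 0%E.
  apply/eqP; rewrite eq_le measure_ge0 andbT.
  have : mu.-negligible N.
    apply: negligible_bigcup => i; case: (ANP (q i)) => _ mNi Ni0 _.
    by exists (AN (q i)).2; split.
  by move/negligibleP => ->.
pose g x := f x * \1_(~` N) x : R.
have gN x : N x -> g x = 0 by move=> Nx; rewrite /g (indic_setC_notin Nx) mulr0.
have gNC x : ~ N x -> g x = f x by move=> Nx; rewrite /g indic_in// mulr1.
exists g; split.
- move=> mT; apply: (measurability _ (RGenOInfty.measurableE R)) => //.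
  move=> _ [_ [a ->] <-]; rewrite setTI.
  rewrite (_ : _ @^-1` _ = (N `&` [set x | a < 0]) `|`
     \bigcup_i ((AN (q i)).1 `&` ~` N `&` [set x | a < ratr (q i)])).
    apply: measurableU.
      have [a0|a0] := ltP a 0.
        by rewrite (_ : [set x | _] = setT) ?setIT//; apply/seteqP; split.
      by rewrite (_ : [set x | _] = set0) ?setI0//; apply/seteqP; split.
    apply: bigcupT_measurable => i.
    have mAN : measurable ((AN (q i)).1 `&` ~` N).
      by apply: measurableI; [case: (ANP (q i))|exact: measurableC].
    have [a0|a0] := ltP a (ratr (q i)).
      by rewrite (_ : [set x | _] = setT) ?setIT//; apply/seteqP; split.
    by rewrite (_ : [set x | _] = set0) ?setI0//; apply/seteqP; split.
  apply/seteqP; split => x /=.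
    rewrite in_itv/= andbT; have [Nx|Nx] := pselect (N x).
      by rewrite gN//; left.
    rewrite gNC// => afx; right.
    have [r] := rat_in_itvoo afx; rewrite in_itv/= => /andP[ar rf].
    exists (choice.pickle r) => //; rewrite /q choice.pickleK/=; split => //; split => //.
    case: (ANP r) => _ _ _ /(_ x) H; apply: set_mem; rewrite -H// => Nr.
    by apply: Nx; exists (choice.pickle r) => //; rewrite /q choice.pickleK.
  rewrite in_itv/= andbT => -[[Nx a0]|[i _ [[Ax Nx] ai]]]; first by rewrite gN.
  rewrite gNC//; apply: lt_trans ai _.
  case: (ANP (q i)) => _ _ _ /(_ x) ->; first exact: mem_set.
  by move=> Nq; apply: Nx; exists i.
- by move=> x; rewrite mulr_ge0.
exists N; split => // x /= fg; apply: contrapT => Nx; apply: fg.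
by rewrite gNC.
Qed.

End null_sets.

(** * Admissible sets and sums over them *)

Section admissible_sets.
Variable R : realType.
Notation mu := (@lebesgue_measure R).
Implicit Types (S : set R).

(** By Bolzano-Weierstrass, a set that is bounded below has no accumulation
    point exactly when it is finite below each height.  This form is the one
    that passes to Minkowski sums and makes an enumeration tend to infinity. *)
Lemma finite_below_admissibleP S :
  admissible S <-> [/\ countable S, infinite_set S, has_lbound S &
    forall t, finite_set (S `&` [set l | l <= t])].
Proof.
have bd (X : set R) (a b : R) : (forall x, X x -> a <= x <= b) -> bounded_set X.
  move=> Xab; exists (Num.max `|a| `|b|); split; first exact: num_real.
  move=> y abm x /Xab/andP[ax xb]; rewrite /= ler_norml; apply/andP; split.
    have : - a <= `|a| by rewrite ler_normr lexx orbT.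
    by move: abm; rewrite gt_max => /andP[]; lra.
  have : b <= `|b| by rewrite ler_normr lexx.
  by move: abm; rewrite gt_max => /andP[]; lra.
split=> [[cS iS ubS lS lpS]|[cS iS [b lbS] finS]].
  split=> // t; apply: contrapT => infS.
  have [b lbS] := lS.
  have [||a /limit_point_infinite_setP aS] :=
    @infinite_bounded_limit_point_nonempty R (S `&` [set l | l <= t]).
  - exact: infS.
  - by apply: (bd _ b t) => x [Sx ->]; rewrite andbT; exact: lbS.
  have : limit_point S a.
    apply/limit_point_infinite_setP => U /aS; apply: sub_infinite_set.
    by move=> x [Ux [Sx _]].
  by rewrite lpS.
split=> //; last 2 first.
- by exists b.
- rewrite -subset0 => a /limit_point_infinite_setP /(_ [set x | x <= a + 1]).
  have na : nbhs a [set x | x <= a + 1].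
    apply: filterS (nbhsx_ballx a (1 : R) ltr01) => x; rewrite /ball/= ltr_distlC.
    by move=> /andP[_ /ltW].
  by move=> /(_ na); apply; rewrite setIC.
move=> [M [_ SM]]; apply: iS; apply: (sub_finite_set _ (finS (`|M| + 1))) => x Sx.
split => //=; apply: le_trans (ler_norm x) _; apply: SM => //.
by rewrite (le_lt_trans (ler_norm M))// ltrDl.
Qed.

Lemma admissible_enum S : admissible S -> exists e : nat -> R,
  [/\ set_bij setT S e, injective e &
    forall t, exists N, forall i, (N <= i)%N -> t < e i].
Proof.
move=> /finite_below_admissibleP[cS iS _ finS].
have := eq_card_nat cS iS; rewrite card_eq_sym => /card_set_bijP[e ebij].
have inje : injective e.
  by case: ebij => _ + _ => inj i j; apply: inj; exact: mem_set.
exists e; split => // t.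
have [] := @finite_set_nat_ubound (e @^-1` (S `&` [set l | l <= t])).
  by apply: finite_preimage => [i j _ _|]; [exact: inje|exact: finS].
move=> N NP; exists N => i Ni; rewrite ltNge; apply/negP => eit.
have : (i < N)%N by apply: NP; split => //; case: ebij => + _ _; apply.
by rewrite ltnNge Ni.
Qed.

Lemma translate_sum_enum (f : R -> R) S e x :
  (forall x, 0 <= f x) -> set_bij setT S e ->
  translate_sum f S x = (\sum_(0 <= i <oo) (f (x + e i))%:E)%E.
Proof.
move=> f0 ebij.
rewrite /translate_sum (@reindex_esum _ _ _ _ _ _ _ ebij) nneseries_esumT//.
by move=> i; rewrite lee_fin.
Qed.

Lemma measurable_translate_sum (f : R -> R) S : (forall x, 0 <= f x) ->
  measurable_fun [set: R] f -> admissible S ->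
  measurable_fun [set: R] (translate_sum f S).
Proof.
move=> f0 mf /admissible_enum[e [ebij _ _]].
rewrite (_ : translate_sum f S = fun x => (\sum_(0 <= i <oo) (f (x + e i))%:E)%E).
  apply: measurable_nneseries => // i; exact: measurable_comp_shift.
by apply/funext => x; exact: translate_sum_enum.
Qed.

Lemma esum_lty_finite_ge1 (S : set R) (a : R -> \bar R) : (forall l, 0 <= a l)%E ->
  (\esum_(l in S) a l < +oo)%E -> finite_set (S `&` [set l | 1 <= a l]%E).
Proof.
move=> a0 afin; apply: contrapT => /infinite_set_fsetP inf.
move: afin; apply/negP; rewrite -leNgt leye_eq; apply/eqP/eq_infty => c.
have [X XS cX] := inf (Num.truncn c).+1.
apply: esum_ge; exists [set` X]; first by split=> // l /XS[].
rewrite fsbig_finite//= set_fsetK.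
apply: (@le_trans _ _ (\sum_(l <- X) 1%:E)%E); last first.
  by rewrite big_seq [leRHS]big_seq; apply: lee_sum => l /XS[].
rewrite sumEFin lee_fin big_const_seq count_predT iter_addr_0.
by apply: le_trans (ltW (truncnS_gt c)) _; rewrite ler_nat.
Qed.

Lemma esum_finite_support_lty (S : set R) (a : R -> R) : (forall l, 0 <= a l) ->
  finite_set (S `&` [set l | a l != 0]) -> (\esum_(l in S) (a l)%:E < +oo)%E.
Proof.
move=> a0 finS.
rewrite (_ : esum _ _ = \esum_(l in S `&` [set l | a l != 0%R]) (a l)%:E)%E.
  rewrite esum_fset//; last by move=> *; rewrite lee_fin.
  by rewrite fsbig_finite//= sumEFin ltry.
rewrite [RHS]esum_mkcondr; apply: eq_esum => l Sl.
by case: ifPn => //; rewrite notin_setE/= => /negP/negPn/eqP ->.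
Qed.

Lemma translate_sum_indic_lty (U : set R) S x :
  (translate_sum \1_U S x < +oo)%E <-> finite_set (S `&` [set l | U (x + l)]).
Proof.
split=> [/esum_lty_finite_ge1 H|finU].
  apply: sub_finite_set (H _) => l; last by rewrite lee_fin.
  by move=> [Sl Uxl]; split=> //=; rewrite indic_in.
apply: esum_finite_support_lty => //.
apply: sub_finite_set finU => l [Sl /=] ul; split=> //=.
by apply: contrapT => /(@indic_notin R) ul0; rewrite ul0 eqxx in ul.
Qed.

End admissible_sets.

(** * Type 1 can be tested on indicators of Borel sets *)

Section criterion.
Variable R : realType.
Notation mu := (@lebesgue_measure R).
Implicit Types (S : set R).

Lemma translate_sum_ae_eq (f g : R -> R) S : countable S ->
  mu.-negligible [set x | f x <> g x] ->
  mu.-negligible [set x | translate_sum f S x <> translate_sum g S x].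
Proof.
move=> cS fg.
move: cS => /pcard_surjP[e eP].
apply: (@negligibleS _ _ _ mu (\bigcup_i [set x | f (x + e i) <> g (x + e i)])).
  move=> x /=; apply: contra_notP => nx; apply: eq_esum => l /eP[i _ <-].
  by congr (_%:E); apply: contrapT => ne; apply: nx; exists i.
by apply: negligible_bigcup => i; exact: (negligible_shift (e i) fg).
Qed.

(** After replacing [f] by a Borel representative [g], its convergence set is
    the union of the bounded sets [C_ n] on which the sum is at most [n], and
    its divergence set that of the bounded sets [D_ n].  If neither is null,
    some [C_ n] and some [D_ m] are not null, and [indicator_witness] provides
    an indicator for which neither set is null. *)
Lemma type1_of_indicators S : admissible S ->
  (forall U : set R, measurable U ->
     mu.-negligible (divergence_set \1_U S) \/
     mu.-negligible (convergence_set \1_U S)) ->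
  type1 S.
Proof.
move=> admS indS; split => // f f0 /(lebesgue_measurable_ae_borel f0)[g [mg g0 fg]].
rewrite !completed_lebesgue_measure_eq0.
have cS : countable S by case: admS.
have fgS := translate_sum_ae_eq cS fg.
suff [gS|gS] : mu.-negligible (divergence_set g S) \/
    mu.-negligible (convergence_set g S).
- left; apply: negligibleS (negligibleU gS fgS) => x.
  rewrite /divergence_set/= => fx.
  by have [<-|] := pselect (translate_sum f S x = translate_sum g S x);
    [left|right].
- right; apply: negligibleS (negligibleU gS fgS) => x.
  rewrite /convergence_set/= => fx.
  by have [<-|] := pselect (translate_sum f S x = translate_sum g S x);
    [left|right].
have [e [ebij inje e_oo]] := admissible_enum admS.
have ms := measurable_translate_sum g0 mg admS.
pose ball_ n : set R := `[- n%:R, n%:R]%classic.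
pose C_ n := ball_ n `&` [set x | (translate_sum g S x <= n%:R%:E)%E].
pose D_ n := ball_ n `&` divergence_set g S.
have mball n : measurable (ball_ n) by exact: measurable_itv.
have ballP n x : ball_ n x <-> `|x| <= n%:R by rewrite /ball_/= in_itv/= ler_norml.
have mC n : measurable (C_ n).
  apply: measurableI => //.
  have := ms measurableT _ (emeasurable_itv (`]-oo, n%:R%:E] : interval \bar R)).
  by rewrite setTI; congr measurable; apply/seteqP; split => x /=; rewrite in_itv.
have mD n : measurable (D_ n).
  apply: measurableI => //.
  by have := ms measurableT _ (emeasurable_set1 +oo%E); rewrite setTI.
have [Cn|/existsNP[n Cn]] := pselect (forall n, mu.-negligible (C_ n)).
  right; apply: negligibleS (negligible_bigcup Cn) => x.
  rewrite /convergence_set/= => sx.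
  pose r := fine (translate_sum g S x).
  have sE : translate_sum g S x = r%:E.
    by rewrite fineK// ge0_fin_numE// esum_ge0// => *; rewrite lee_fin.
  exists (Num.truncn (Num.max `|x| r)).+1 => //; split.
    by apply/ballP; rewrite (le_trans _ (ltW (truncnS_gt _)))// le_max lexx.
  by rewrite /= sE lee_fin (le_trans _ (ltW (truncnS_gt _)))// le_max lexx orbT.
have [Dn|/existsNP[m Dm]] := pselect (forall n, mu.-negligible (D_ n)).
  left; apply: negligibleS (negligible_bigcup Dn) => x sx.
  exists (Num.truncn `|x|).+1 => //; split => //.
  by apply/ballP/ltW/truncnS_gt.
exfalso.
have [] := @indicator_witness R e g (C_ n) (D_ m) (maxn n m)%:R n%:R
  inje e_oo mg g0 (mC n) (mD m).
- by move=> x [/ballP xn _]; apply: le_trans xn _; rewrite ler_nat leq_maxl.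
- by move=> x [/ballP xn _]; apply: le_trans xn _; rewrite ler_nat leq_maxr.
- by move=> x [_ /=]; rewrite (translate_sum_enum x g0 ebij).
- by move=> x [_]; rewrite /divergence_set/= (translate_sum_enum x g0 ebij).
have hitsE (U : set R) x : finite_set [set i | U (x + e i)] <->
    finite_set (S `&` [set l | U (x + l)]).
  split=> fin.
    apply: sub_finite_set (finite_image e fin) => l [Sl Uxl].
    case: ebij => _ _ /(_ _ Sl)[i _ il]; exists i => //=.
    by rewrite il.
  apply: (@sub_finite_set _ _ (e @^-1` (S `&` [set l | U (x + l)]))).
    by move=> i Ui; split => //; case: ebij => + _ _; apply.
  by apply: finite_preimage => // i j _ _; exact: inje.
move=> U [mU CU DU]; case: (indS U mU) => negU.
  apply: Dm; apply: negligibleS (negligibleU DU negU) => x Dx.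
  have [fin|inf] := pselect (finite_set [set i | U (x + e i)]); first by left.
  right; rewrite /divergence_set/=; apply/eqP; rewrite -leye_eq leNgt; apply/negP.
  by move/translate_sum_indic_lty/hitsE.
apply: Cn; apply: negligibleS (negligibleU CU negU) => x Cx.
have [fin|inf] := pselect (finite_set [set i | U (x + e i)]); last by left.
by right; apply/translate_sum_indic_lty/hitsE.
Qed.
End criterion.

(** * The Minkowski sum *)

Section minkowski.
Variable R : realType.
Notation mu := (@lebesgue_measure R).
Variables (L L' : set R).

Lemma minkowski_sum_admissible : admissible L -> admissible L' ->
  admissible (minkowski_sum L L').
Proof.
move=> /finite_below_admissibleP[cL iL [b lb] finL].
move=> /finite_below_admissibleP[cL' iL' [b' lb'] finL'].
apply/finite_below_admissibleP; split.
- rewrite (_ : minkowski_sum L L' = \bigcup_(x in L) [set x + y | y in L']).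
    apply: bigcup_countable => // x _.
    exact: sub_countable (card_image_le _ _) cL'.
  apply/seteqP; split => [_ [x Lx [y Ly <-]]|_ [x Lx [y Ly <-]]].
    by exists x => //; exists y.
  by exists x => //; exists y.
- have [l Ll] := infinite_setN0 iL.
  move=> fin; apply: iL'.
  apply: (sub_finite_set _ (finite_image (fun z => z - l) fin)) => y Ly.
  by exists (l + y); [exists l => //; exists y|rewrite addrC addKr].
- exists (b + b') => _ [x Lx [y Ly <-]].
  by apply: lerD; [exact: lb|exact: lb'].
move=> t; apply: sub_finite_set
  (finite_image2 (fun x y => x + y) (finL (t - b')) (finL' (t - b))).
move=> _ [[x Lx [y Ly <-]] /= xyt]; have := lb _ Lx; have := lb' _ Ly.
by move=> ? ?; exists x; [|exists y => //]; split => //=; lra.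
Qed.

Lemma lebesgue_measurable_of_borel (f : R -> R) : measurable_fun [set: R] f ->
  lebesgue_measurable_fun f.
Proof.
move=> mf _ Y mY; have := mf measurableT Y mY; rewrite !setTI => ?.
exact: sub_caratheodory.
Qed.

Lemma translate_sum_indic_ge1 (U : set R) (S : set R) x l : S l -> U (x + l) ->
  (1 <= translate_sum \1_U S x)%E.
Proof.
move=> Sl Uxl; apply: esum_ge; exists [set l].
  by split; [exact: finite_set1|move=> _ ->].
by rewrite fsbig_set1 indic_in.
Qed.

(** The function [g] counts the hits [x + l' \in U] with [l'] in [L'].  Its
    values are natural numbers, so its sum over [L] converges if and only if it
    vanishes at all but finitely many translates.  With finitely many
    representations of each element of the sum set, this amounts to a finite
    number of hits over the sum set. *)
Lemma minkowski_sum_indicator (U : set R) : type1 L -> type1 L' -> measurable U ->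
  mu.-negligible (divergence_set \1_U (minkowski_sum L L')) \/
  mu.-negligible (convergence_set \1_U (minkowski_sum L L')).
Proof.
move=> [aL tL] [aL' tL'] mU; set S := minkowski_sum L L'.
have U0 x : 0 <= \1_U x :> R by [].
have mUi : measurable_fun [set: R] (\1_U : R -> R) by exact: measurable_indic.
have [CU|CU] := pselect (mu.-negligible (convergence_set \1_U S)); first by right.
left.
have := aL; rewrite finite_below_admissibleP => -[cL iL _ finL].
have := aL'; rewrite finite_below_admissibleP => -[_ _ [b' lb'] _].
have [l0 Ll0] := infinite_setN0 iL.
have N0 : mu.-negligible (divergence_set \1_U L').
  have [/completed_lebesgue_measure_eq0//|/completed_lebesgue_measure_eq0 C'] :=
    tL' _ U0 (lebesgue_measurable_of_borel mUi).
  case: CU; apply: negligibleS (negligible_shift l0 C') => x.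
  rewrite /convergence_set/= => /translate_sum_indic_lty fin.
  apply/translate_sum_indic_lty.
  apply: (sub_finite_set _ (finite_image (fun z => z - l0) fin)) => y [Ly Uy].
  exists (l0 + y); last by rewrite addrC addKr.
  by split; [exists l0 => //; exists y|rewrite /= addrA].
(* [fine] sends [+oo] to [0], so [g] is the number of hits except on the null
   set where that number is infinite. *)
pose g x := fine (translate_sum \1_U L' x).
have s0 x : (0 <= translate_sum \1_U L' x)%E.
  by apply: esum_ge0 => *; rewrite lee_fin.
have g0 x : 0 <= g x by exact: fine_ge0.
have mg : measurable_fun [set: R] g.
  apply: measurableT_comp => //.
  exact: measurable_translate_sum.
have [/completed_lebesgue_measure_eq0 Dg|/completed_lebesgue_measure_eq0 Cg] :=
  tL _ g0 (lebesgue_measurable_of_borel mg); last first.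
  case: CU; apply: negligibleS Cg => x; rewrite /convergence_set/=.
  move=> /translate_sum_indic_lty fin.
  apply: esum_finite_support_lty => //.
  apply: (@sub_finite_set _ _ (\bigcup_(v in S `&` [set l | U (x + l)])
      (L `&` [set l | l <= v - b']))); last first.
    by apply: bigcup_finite => // v _; exact: finL.
  move=> l [Ll /= gl]; apply: contrapT => nl; move: gl; apply/negP/negPn/eqP.
  rewrite /g /translate_sum esum1// => l' Ll'; rewrite indic_notin// => Uxll'.
  apply: nl; exists (l + l').
    by split; [exists l => //; exists l'|rewrite /= addrA].
  by split => //=; have := lb' _ Ll'; lra.
move: cL => /pcard_surjP[e eP].
have shiftN : mu.-negligible (\bigcup_i [set x | divergence_set \1_U L' (x + e i)]).
  by apply: negligible_bigcup => i; exact: negligible_shift.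
apply: negligibleS (negligibleU Dg shiftN) => x Dx.
apply: contrapT => /not_orP[nDg nN].
have fin' l : L l -> (translate_sum \1_U L' (x + l) < +oo)%E.
  move=> /eP[i _ <-]; rewrite ltey; apply/eqP => Di.
  by apply: nN; exists i.
have : (translate_sum g L x < +oo)%E by rewrite ltey; exact/eqP.
move=> /esum_lty_finite_ge1 H.
have {}H : finite_set (L `&` [set l | (1 <= (g (x + l))%:E)%E]).
  by apply: H => l; rewrite lee_fin.
move: Dx; rewrite /divergence_set/=; apply/eqP; rewrite -ltey.
apply/translate_sum_indic_lty.
apply: (@sub_finite_set _ _ (\bigcup_(l in L `&` [set l | (1 <= (g (x + l))%:E)%E])
   [set l + l' | l' in L' `&` [set l' | U (x + l + l')]])); last first.
  apply: bigcup_finite => // l [Ll _]; apply: finite_image.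
  exact/translate_sum_indic_lty/fin'.
move=> _ [[l Ll [l' Ll' <-]] /= Ull']; rewrite addrA in Ull'.
exists l; last by exists l'.
split => //=; rewrite /g fineK; first exact: translate_sum_indic_ge1 Ll' Ull'.
by rewrite ge0_fin_numE// fin'.
Qed.

End minkowski.

Theorem theorem4p3 (R : realType) (Lambda Lambda' : set R)
  (hLambda : type1 Lambda) (hLambda' : type1 Lambda') :
  type1 (minkowski_sum Lambda Lambda').
Proof.
apply: type1_of_indicators => [|U mU].
  by apply: minkowski_sum_admissible; [case: hLambda|case: hLambda'].
exact: minkowski_sum_indicator.
Qed.
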